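(* Let $k\geq 1$ be an integer and let $\gamma=(\gamma_0,\ldots,\gamma_k)$ be a sequence of positive real numbers. Then $T_\gamma(II^{\geq}_k)\subseteq II^{\geq}_k$ if and only if $$\gamma_j^k\leq\left(\frac{\gamma_k}{\gamma_0}\right)^j\quad\text{for all } j\in\{1,\ldots,k-1\}.$$
   Context: For $\gamma=(\gamma_0,\ldots,\gamma_k)$, the diagonal operator $T_\gamma$ is the linear map on real polynomials of degree at most $k$ with $T_\gamma(x^j)=\gamma_jx^j$ for $0\leq j\leq k$. $II^{\geq}_k$ is the set of real polynomials $p(x)=a_0+a_1x+\cdots+a_kx^k$ such that: (i) $a_j\geq 0$ for all $j$; (ii) $a_0,a_k>0$; (iii) $p$ has exactly $1$ real root if $k$ is odd and exactly $0$ real roots if $k$ is even; (iv) every polynomial $p^*$ obtained from $p$ by multiplying any subset of the coefficients $a_i$ with $i\in\{1,\ldots,k-1\}$ by $-1$ also has exactly $1$ real root if $k$ is odd and exactly $0$ real roots if $k$ is even.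
   Formalization: The printed inequality fails when γ_0 ≠ 1 (k=2, γ=(2,2,2) gives T_γ p = 2p, yet 4 ≤ 1 is false); it is replaced by (γ_j/γ_0)^k ≤ (γ_k/γ_0)^j for 1 ≤ j ≤ k−1, which agrees with it when γ_0 = 1. *)

(* Defs.v *)
From HB Require Import structures.
From mathcomp Require Import all_boot all_order all_algebra.
From mathcomp Require Import polyrcf.
From mathcomp Require Import classical_sets reals.

Set Implicit Arguments.
Unset Strict Implicit.
Unset Printing Implicit Defensive.

Import Order.TTheory GRing.Theory Num.Theory.
Local Open Scope ring_scope.
Local Open Scope classical_set_scope.

(* T_gamma lives on the polynomials of degree at most k; on all of {poly R} this
   is its extension by 0 on the monomials of degree > k. *)
Definition diag_op (R : realType) (k : nat) (gamma : 'I_k.+1 -> R)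
    (p : {poly R}) : {poly R} :=
  \sum_(j < k.+1) (gamma j * p`_j) *: 'X^j.

Lemma diag_op_is_linear (R : realType) (k : nat) (gamma : 'I_k.+1 -> R) :
  linear (diag_op gamma).
Proof.
move=> a p q; rewrite /diag_op scaler_sumr -big_split /=; apply: eq_bigr => j _.
by rewrite coefD coefZ mulrDr scalerDl scalerA mulrCA.
Qed.

Lemma diag_op_Xn (R : realType) (k : nat) (gamma : 'I_k.+1 -> R) (j : 'I_k.+1) :
  diag_op gamma 'X^j = gamma j *: 'X^j.
Proof.
rewrite /diag_op (bigD1 j) //= coefXn eqxx mulr1 big1 ?addr0 // => i nij.
by rewrite coefXn val_eqE (negPf nij) mulr0 scale0r.
Qed.

Definition flip_signs (R : realType) (k : nat) (S : {set 'I_k.+1})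
    (p : {poly R}) : {poly R} :=
  \sum_(j < k.+1) (if j \in S then - p`_j else p`_j) *: 'X^j.

(* Real roots are counted without multiplicity: rootsR p is the duplicate-free
   list of the roots of p <> 0 in R. *)
Definition minimal_real_roots (R : realType) (k : nat) (p : {poly R}) : Prop :=
  size (rootsR p) = if odd k then 1%N else 0%N.

Definition II_ge (R : realType) (k : nat) : set {poly R} :=
  [set p : {poly R} |
    [/\ (size p <= k.+1)%N,
        forall j : 'I_k.+1, 0 <= p`_j,
        0 < p`_0 /\ 0 < p`_k,
        minimal_real_roots k p
      & forall S : {set 'I_k.+1},
          (forall j : 'I_k.+1, j \in S -> (0 < j < k)%N) ->
          minimal_real_roots k (flip_signs S p)]].

(* Main.v *)
(* A polynomial p with nonnegative coefficients and a_0, a_k > 0 lies in II_ge k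
   exactly when a_0 + a_k x^k > sum_(0 < j < k) a_j x^j for all x > 0.  Flipping
   every interior sign shows necessity.  For sufficiency only the uniqueness of the
   negative root for odd k is delicate: after division by |x|^(k/2) every
   sign-flipped polynomial is strictly monotone on the negative axis, because
   |j - k/2| <= k/2.  The criterion is stable under decreasing the interior
   coefficients and under x -> t x; with t^k = gamma_k / gamma_0 the condition
   on gamma reads gamma_j <= gamma_0 t^j, so it is sufficient.  If it fails at j,
   then (k - j) + c k x^j + j x^k, with c = gamma_0 t^j / gamma_j < 1, is in
   II_ge k by the weighted AM-GM inequality, while its image violates the
   criterion at x = 1/t. *)
Require Import Defs.
From mathcomp Require Import all_boot all_order all_algebra.
From mathcomp Require Import polyrcf ring lra.
From mathcomp Require Import classical_sets reals.

Set Implicit Arguments.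
Unset Strict Implicit.
Unset Printing Implicit Defensive.

Import Order.TTheory GRing.Theory Num.Theory.
Local Open Scope ring_scope.
Local Open Scope classical_set_scope.

(** * Polynomials given as sums of monomials *)

Lemma coef_sumZX (R : nzRingType) (n : nat) (c : 'I_n -> R) (i : 'I_n) :
  (\sum_(j < n) c j *: 'X^j)`_i = c i.
Proof.
rewrite coef_sum (bigD1 i) //= coefZ coefXn eqxx mulr1 big1 ?addr0 // => j ji.
by rewrite coefZ coefXn eq_sym val_eqE (negPf ji) mulr0.
Qed.

Lemma size_sumZX (R : nzRingType) (n : nat) (c : 'I_n -> R) :
  (size (\sum_(j < n) c j *: 'X^j)%R <= n)%N.
Proof.
apply: leq_trans (size_sum _ _ _) _; apply/bigmax_leqP => j _.
by apply: leq_trans (size_scale_leq _ _) _; rewrite size_polyXn.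
Qed.

(** * Dominance of the two end terms *)

(* The sum includes j = 0 and j = k, whence the factor 2. *)
Definition dominant (R : numDomainType) (k : nat) (q : {poly R}) : Prop :=
  forall x : R, 0 < x ->
    \sum_(j < k.+1) `|q`_j| * x ^+ j < 2 * (q`_0 + q`_k * x ^+ k).

(** Dominance, scaled by [D], says that the end terms outweigh the interior terms in absolute value.
    General weights [w] cover both one value of [q] and a combination of two values. *)
Lemma dominant_sum_gt0 (R : realDomainType) (k : nat) (q : {poly R})
    (x D : R) (w : nat -> R) :
  (0 < k)%N -> dominant k q -> 0 <= q`_0 -> 0 <= q`_k -> 0 < x -> 0 < D ->
  (forall j, (j <= k)%N -> `|w j| <= D * x ^+ j) ->
  w 0%N = D -> w k = D * x ^+ k ->
  0 < \sum_(j < k.+1) q`_j * w j.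
Proof.
case: k => // k _ dom q0 qk x0 D0 wle w0 wk.
have := dom x x0; rewrite -(ltr_pM2l D0) mulr_sumr => domD.
have : 0 <= \sum_(j < k) (q`_j.+1 * w j.+1 + D * (`|q`_j.+1| * x ^+ j.+1)).
  apply: sumr_ge0 => j _; rewrite addrC -[X in _ + X]opprK subr_ge0.
  apply: le_trans (ler_norm _) _; rewrite normrN normrM mulrCA.
  by rewrite ler_wpM2l // wle // ltnS ltnW.
rewrite big_split /= => mid.
move: domD; rewrite big_ord_recl big_ord_recr /=.
rewrite [X in _ -> 0 < X]big_ord_recl [X in _ -> 0 < _ + X]big_ord_recr /=.
rewrite /bump /= !add1n w0 wk !ger0_norm //; under eq_bigr do rewrite add1n.
under [X in _ -> 0 < _ + (X + _)]eq_bigr do rewrite add1n.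
lra.
Qed.

(** The condition on [|x| ^+ k] admits every positive [x], and negative [x] when [k] is even. *)
Lemma dominant_horner_gt0 (R : realDomainType) (k : nat) (q : {poly R}) (x : R) :
  (0 < k)%N -> (size q <= k.+1)%N -> dominant k q -> 0 <= q`_0 -> 0 <= q`_k ->
  x != 0 -> `|x| ^+ k = x ^+ k -> 0 < q.[x].
Proof.
move=> k0 sq dom q0 qk x0 xk; rewrite (horner_coef_wide _ sq).
apply: (@dominant_sum_gt0 R k q `|x| 1 (fun j => x ^+ j)) => //.
- by rewrite normr_gt0.
- by move=> j _; rewrite mul1r normrX.
- by rewrite mul1r.
Qed.

(* If q vanishes at -z^2 and at -v^2, apply dominance at x = zv to the
   combination v^k q(-z^2) - z^k q(-v^2). *)
Lemma dominant_neg_root_uniq (R : rcfType) (k : nat) (q : {poly R}) (a b : R) :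
  odd k -> (size q <= k.+1)%N -> dominant k q -> 0 <= q`_0 -> 0 <= q`_k ->
  root q (- a) -> root q (- b) -> 0 < a -> 0 < b -> ~~ (a < b).
Proof.
move=> ok sq dom q0 qk /rootP ra /rootP rb a0 b0; apply/negP => ab.
have k0 : (0 < k)%N by case: (k) ok.
set z := Num.sqrt a; set v := Num.sqrt b.
have z0 : 0 < z by rewrite sqrtr_gt0.
have v0 : 0 < v by rewrite sqrtr_gt0.
have zv : z < v by rewrite ltr_sqrt.
have Ea : a = z ^+ 2 by rewrite sqr_sqrtr // ltW.
have Eb : b = v ^+ 2 by rewrite sqr_sqrtr // ltW.
have D0 : 0 < v ^+ k - z ^+ k by rewrite subr_gt0 ltr_pXn2r // nnegrE ltW.
(* Since v^k z^(2j) - z^k v^(2j) = (zv)^j [d j], the weights [w j] are those of the combination.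
   Both products in [d j] lie between z^k and v^k, which bounds [w j]; oddness of k gives [w k] its
   positive sign. *)
pose d j := z ^+ j * v ^+ (k - j) - v ^+ j * z ^+ (k - j).
pose w j := (-1) ^+ j * (z * v) ^+ j * d j.
suff: 0 < \sum_(j < k.+1) q`_j * w j.
  have -> : \sum_(j < k.+1) q`_j * w j = v ^+ k * q.[- a] - z ^+ k * q.[- b].
    rewrite !(horner_coef_wide _ sq) !mulr_sumr -sumrB; apply: eq_bigr => j _.
    have jk : (j <= k)%N by rewrite -ltnS.
    have spl (c : R) : c ^+ k = c ^+ (k - j) * c ^+ j by rewrite -exprD subnK.
    rewrite /w /d Ea Eb !spl !(exprNn (_ ^+ 2)) !(exprAC _ 2) !exprMn; ring.
  by rewrite ra rb !mulr0 subrr ltxx.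
apply: (@dominant_sum_gt0 R k q (z * v) (v ^+ k - z ^+ k) w) => //.
- exact: mulr_gt0.
- move=> j jk; rewrite /w normrM normrMsign ger0_norm; last first.
    by rewrite exprn_ge0 // mulr_ge0 // ltW.
  rewrite mulrC ler_wpM2r ?exprn_ge0 ?mulr_ge0 ?(ltW z0) ?(ltW v0) // /d.
  have bnd i : (i <= k)%N -> z ^+ k <= z ^+ i * v ^+ (k - i) <= v ^+ k.
    move=> ik; have zi := exprn_ge0 i (ltW z0); have vi := exprn_ge0 (k - i) (ltW v0).
    have spl (c : R) : c ^+ k = c ^+ i * c ^+ (k - i) by rewrite -exprD subnKC.
    rewrite (spl z) (spl v).
    have le n : z ^+ n <= v ^+ n by rewrite lerXn2r ?nnegrE ?ltW.
    by rewrite ler_wpM2l ?le // ler_wpM2r ?le.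
  have := bnd j jk; have := bnd (k - j)%N (leq_subr _ _).
  rewrite subKn // [z ^+ (k - j) * _]mulrC ler_norml; lra.
- by rewrite /w /d !expr0 subn0 !mul1r.
- rewrite /w /d subnn -signr_odd ok !expr0; ring.
Qed.

(** * Counting real roots *)

(** Odd degree and a positive leading coefficient make [q] negative at minus the Cauchy bound, while
    [q] is positive at 0. *)
Lemma odd_neg_root (R : rcfType) (k : nat) (q : {poly R}) :
  odd k -> (size q <= k.+1)%N -> 0 < q`_0 -> 0 < q`_k ->
  exists2 x : R, x < 0 & root q x.
Proof.
move=> ok sq q0 qk.
have Es : size q = k.+1.
  apply/eqP; rewrite eqn_leq sq ltnNge; apply/negP => h.
  by move: qk; rewrite nth_default // ltxx.
have qn0 : q != 0 by rewrite -size_poly_eq0 Es.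
pose b := cauchy_bound q.
have [||x xb rx] := @poly_ivtoo R q (- b) 0.
- by rewrite oppr_le0 cauchy_bound_ge0.
- rewrite horner_coef0 pmulr_llt0 // -sgr_cp0.
  rewrite (sgp_minftyP (le_cauchy_bound qn0)) ?bound_in_itv //.
  rewrite /sgp_minfty lead_coefE Es -signr_odd ok expr1 mulN1r.
  by rewrite sgrN gtr0_sg.
- by exists x => //; rewrite (itvP xb).
Qed.

Lemma mem_rootsR (R : rcfType) (p : {poly R}) (x : R) :
  p != 0 -> (x \in rootsR p) = root p x.
Proof. by move=> p0; rewrite -(roots_on_rootsR p0) in_itv. Qed.

Lemma dominant_minimal_real_roots (R : realType) (k : nat) (q : {poly R}) :
  (0 < k)%N -> (size q <= k.+1)%N -> dominant k q -> 0 < q`_0 -> 0 < q`_k ->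
  minimal_real_roots k q.
Proof.
move=> k0 sq dom q0 qk.
have qn0 : q != 0 by apply: contraTneq q0 => ->; rewrite coef0 ltxx.
have nz x : root q x -> x != 0.
  by apply: contraTneq => ->; rewrite rootE horner_coef0 gt_eqF.
rewrite /minimal_real_roots; case: ifP => ok; last first.
  apply/eqP/negPn; rewrite -lt0n -has_predT; apply/negP => /hasP[x].
  rewrite mem_rootsR // => rx _; have := rx; rewrite rootE gt_eqF //.
  apply: (@dominant_horner_gt0 R k) => //; rewrite ?nz ?ltW //.
  by rewrite real_normrEsign ?num_real // exprMn -exprM mulnC exprM -signr_odd
     ok expr0 expr1n mul1r.
have neg x : root q x -> 0 < - x.
  move=> rx; rewrite oppr_gt0 ltNge; apply/negP => x0.
  have := rx; rewrite rootE gt_eqF //.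
  by apply: (@dominant_horner_gt0 R k); rewrite ?nz ?ltW // ger0_norm.
have [x _ rx] := odd_neg_root ok sq q0 qk.
have sub : {subset rootsR q <= [:: x]}.
  move=> y; rewrite mem_rootsR // inE => ry.
  have h a b : root q a -> root q b -> ~~ (- a < - b).
    move=> ra rb; apply: (@dominant_neg_root_uniq R k q) => //;
      by rewrite ?opprK ?ltW ?neg.
  by rewrite -(inj_eq oppr_inj) eq_le !leNgt !h.
apply/eqP; rewrite eqn_leq (uniq_leq_size (uniq_roots _ _ _) sub) /=.
by rewrite -has_predT; apply/hasP; exists x => //; rewrite mem_rootsR.
Qed.

(** * Dominance characterises [II_ge] *)

Lemma II_ge_dominant (R : realType) (k : nat) (p : {poly R}) : (0 < k)%N ->
  II_ge k p <->
  [/\ (size p <= k.+1)%N, forall j : 'I_k.+1, 0 <= p`_j,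
      0 < p`_0 /\ 0 < p`_k & dominant k p].
Proof.
move=> k0; split=> [[sp pge [p0 pk] _ flip]|[sp pge [p0 pk] dom]]; last first.
  split => //; first exact: dominant_minimal_real_roots.
  move=> S hS; pose s := flip_signs S p.
  have cs (j : 'I_k.+1) : s`_j = if j \in S then - p`_j else p`_j.
    exact: coef_sumZX.
  have s0 : s`_0 = p`_0.
    by rewrite (cs ord0); case: ifP => // /hS.
  have sk : s`_k = p`_k.
    by rewrite (cs ord_max); case: ifP => // /hS; rewrite /= ltnn andbF.
  apply: dominant_minimal_real_roots => //; rewrite -/s ?s0 ?sk //.
    exact: size_sumZX.
  (* Dominance sees only absolute values of interior coefficients, so sign flips preserve it. *)
  move=> x x0; rewrite s0 sk; under eq_bigr => j _ do
    rewrite cs (fun_if Num.norm) normrN if_same.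
  exact: dom.
split => // x x0; rewrite ltNge; apply/negP => hx.
pose S := [set j : 'I_k.+1 | (0 < j < k)%N]%SET.
pose s := flip_signs S p.
have {flip}/flip : forall j : 'I_k.+1, j \in S -> (0 < j < k)%N.
  by move=> j; rewrite inE.
rewrite -/s => flip.
have cs (j : 'I_k.+1) : s`_j = if j \in S then - p`_j else p`_j.
  exact: coef_sumZX.
have s0 : s`_0 = p`_0 by rewrite (cs ord0) inE.
have sk : s`_k = p`_k by rewrite (cs ord_max) inE /= ltnn andbF.
have ss : (size s <= k.+1)%N by exact: size_sumZX.
have sn0 : s != 0 by apply: contraTneq p0 => s_0; rewrite -s0 s_0 coef0 ltxx.
(* With all interior signs flipped, failure of dominance at [x] means exactly that [s] is
   nonpositive there. *)
have sx : s.[x] <= 0.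
  rewrite (horner_coef_wide _ ss).
  have Ep (j : 'I_k.+1) : `|p`_j| = p`_j by rewrite ger0_norm.
  move: hx; under eq_bigr do rewrite Ep.
  case: (k) k0 @S @s cs {ss sn0 flip pge} pk s0 sk Ep => // n _ S s cs pk s0 sk Ep.
  rewrite big_ord_recl big_ord_recr [X in _ -> X <= _]big_ord_recl.
  rewrite [X in _ -> _ + X <= _]big_ord_recr /= /bump /= !add1n s0 sk !expr0.
  rewrite (_ : \sum_(i < n) s`_(1 + i) * x ^+ (1 + i) =
     - \sum_(i < n) p`_(1 + i) * x ^+ (1 + i)); first lra.
  rewrite -sumrN; apply: eq_bigr => i _.
  rewrite (cs (lift ord0 (widen_ord (leqnSn n) i))) inE /= /bump /= add1n.
  by rewrite ltnS ltn_ord mulNr.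
have [||y yx ry] := @polyrcf.poly_ivt R s 0 x; first exact: ltW.
  by rewrite horner_coef0 s0 mulr_ge0_le0 // ltW.
move: flip; rewrite /minimal_real_roots; case: ifP => ok size1; last first.
  by move: ry; rewrite -mem_rootsR // (size0nil size1).
(* For odd k the negative root [z] differs from [y], which is nonnegative: two roots where only one
   is allowed. *)
have [||z z0 rz] := @odd_neg_root R k s ok ss; rewrite ?s0 ?sk //.
have : (size [:: y; z] <= size (rootsR s))%N.
  apply: uniq_leq_size.
    by rewrite /= inE andbT gt_eqF // (lt_le_trans z0) // (itvP yx).
  by move=> u; rewrite !inE => /orP[] /eqP ->; rewrite mem_rootsR.
by rewrite size1.
Qed.

(** * Weighted AM-GM and k-th roots *)

(** The difference of the two sides is the sum of (y - 1)(y^(j+i) - y^l) over i < m and l < j. As l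
    <= j + i, both factors have the same sign. *)
Lemma weighted_AGM (R : realDomainType) (j m : nat) (y : R) : 0 <= y ->
  (j + m)%:R * y ^+ j <= j%:R * y ^+ (j + m) + m%:R.
Proof.
move=> y0; have ge0 i l : 0 <= (y - 1) * (y ^+ (j + i - l) - 1) * y ^+ l.
  rewrite subrX1 mulrA -expr2 mulr_ge0 ?exprn_ge0 // mulr_ge0 ?sqr_ge0 //.
  by apply: sumr_ge0 => n _; rewrite exprn_ge0.
have : 0 <= \sum_(i < m) \sum_(l < j) (y - 1) * (y ^+ (j + i - l) - 1) * y ^+ l.
  by apply: sumr_ge0 => i _; apply: sumr_ge0 => l _.
have -> : \sum_(i < m) \sum_(l < j) (y - 1) * (y ^+ (j + i - l) - 1) * y ^+ l =
    \sum_(i < m) (j%:R * y ^+ j * ((y - 1) * y ^+ i) - (y ^+ j - 1)).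
  apply: eq_bigr => i _; rewrite [y ^+ j - 1]subrX1 mulr_sumr.
  transitivity (\sum_(l < j) ((y - 1) * y ^+ (j + i) - (y - 1) * y ^+ l)).
    apply: eq_bigr => l _; rewrite -{2}(subnK (_ : (l <= j + i)%N)).
      by rewrite exprD; ring.
    by rewrite (leq_trans (ltnW (ltn_ord l))) // leq_addr.
  by rewrite sumrB sumr_const card_ord -mulr_natl exprD; congr (_ - _); ring.
rewrite sumrB -mulr_sumr -mulr_sumr -subrX1 sumr_const card_ord -mulr_natl.
by rewrite exprD natrD; lra.
Qed.

Lemma exists_nth_root (R : rcfType) (k : nat) (a : R) : (0 < k)%N -> 0 < a ->
  exists2 t : R, 0 < t & t ^+ k = a.
Proof.
move=> k0 a0; have [||t t01 rt] := @polyrcf.poly_ivt R ('X^k - a%:P) 0 (1 + a).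
(* The right endpoint works because (1 + a)^k >= 1 + a >= a. *)
- by rewrite addr_ge0 // ltW.
- rewrite !hornerE expr0n gtn_eqF // sub0r nmulr_rle0 ?oppr_lt0 // subr_ge0.
  apply: le_trans (_ : (1 + a) ^+ 1 <= _); first by rewrite expr1 lerDr.
  by rewrite ler_weXn2l // lerDl ltW.
have tk : t ^+ k = a by apply/eqP; rewrite -subr_eq0; move: rt; rewrite rootE !hornerE.
exists t => //; rewrite lt0r (itvP t01) andbT.
by apply: contraTneq a0 => t0; rewrite -tk t0 expr0n gtn_eqF // ltxx.
Qed.

(** * Diagonal operators preserving [II_ge] *)

Theorem theorem2 (R : realType) (k : nat) (hk : (1 <= k)%N)
    (gamma : 'I_k.+1 -> R) (hgamma : forall j : 'I_k.+1, 0 < gamma j) :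
  (diag_op gamma @` @II_ge R k `<=` @II_ge R k)
  <->
  (forall j : 'I_k.+1, (0 < j < k)%N ->
     (gamma j / gamma ord0) ^+ k <= (gamma ord_max / gamma ord0) ^+ j).
Proof.
have g0 := hgamma ord0; have gk := hgamma ord_max.
have [t t0 tk] := @exists_nth_root R k _ hk (divr_gt0 gk g0).
have gkE : gamma ord_max = gamma ord0 * t ^+ k by rewrite tk mulrC divfK ?gt_eqF.
have cond (j : 'I_k.+1) :
    ((gamma j / gamma ord0) ^+ k <= (gamma ord_max / gamma ord0) ^+ j) =
    (gamma j <= gamma ord0 * t ^+ j).
  rewrite -tk exprAC ler_pXn2r ?nnegrE ?exprn_ge0 ?divr_ge0 ?(ltW t0) ?(ltW g0) ?(ltW (hgamma j)) //.
  by rewrite ler_pdivrMr // mulrC.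
have cT p (j : 'I_k.+1) : (diag_op gamma p)`_j = gamma j * p`_j.
  exact: coef_sumZX.
split=> [sub j jk|le_g _ [p /(II_ge_dominant _ hk)[sp pge [p0 pk] dom] <-]].
- rewrite cond leNgt; apply/negP => gt_g; have [j0 jlt] := andP jk.
  pose c := gamma ord0 * t ^+ j / gamma j.
  have c0 : 0 < c by rewrite divr_gt0 ?mulr_gt0 ?exprn_gt0.
  have c1 : c < 1 by rewrite ltr_pdivrMr ?mul1r.
  have cE : gamma j * c = gamma ord0 * t ^+ j by rewrite mulrC divfK ?gt_eqF.
  clearbody c.
  pose a (i : 'I_k.+1) : R := if i == ord0 then (k - j)%:R else
    if i == ord_max then j%:R else if i == j then c * k%:R else 0.
  pose p := \sum_(i < k.+1) a i *: 'X^i.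
  have cp (i : 'I_k.+1) : p`_i = a i by exact: coef_sumZX.
  have k00 : @ord_max k == ord0 = false by rewrite -val_eqE /= gtn_eqF.
  have j00 : j == ord0 = false by rewrite -val_eqE /= gtn_eqF.
  have jm : j == ord_max = false by rewrite -val_eqE /= ltn_eqF.
  have p0 : p`_0 = (k - j)%:R by rewrite (cp ord0) /a eqxx.
  have pk : p`_k = j%:R by rewrite (cp ord_max) /a eqxx k00.
  have pj : p`_j = c * k%:R by rewrite cp /a eqxx j00 jm.
  (* Only the indices 0, k and j carry nonzero coefficients. *)
  have sum3 (F : 'I_k.+1 -> R) : (forall i, a i = 0 -> F i = 0) ->
      \sum_i F i = F ord0 + F ord_max + F j.
    move=> F0; rewrite (bigD1 ord0) //= (bigD1 ord_max) ?k00 //=.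
    rewrite (bigD1 j) ?j00 ?jm //= big1 ?addr0 ?addrA // => i /andP[/andP[i0 im] ij].
    by apply: F0; rewrite /a (negPf i0) (negPf im) (negPf ij).
  have a_ge0 i : 0 <= a i.
    by rewrite /a; do 3!case: ifP => // _; rewrite mulr_ge0 ?ler0n ?(ltW c0).
  have : II_ge k (diag_op gamma p).
    apply: sub; exists p => //; apply/(II_ge_dominant _ hk); split.
    + exact: size_sumZX.
    + by move=> i; rewrite cp.
    + by rewrite p0 pk !ltr0n subn_gt0.
    move=> x x0; rewrite sum3 => [|i ai]; last by rewrite cp ai normr0 mul0r.
    rewrite /= p0 pk pj expr0 !ger0_norm ?mulr_ge0 ?ler0n ?(ltW c0) //.
    (* AM-GM with weights j and k - j gives the weak inequality; c < 1 makes it strict. *)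
    have := @weighted_AGM R j (k - j) x (ltW x0); rewrite subnKC ?(ltnW jlt) //.
    have : c * (k%:R * x ^+ j) < k%:R * x ^+ j.
      by rewrite gtr_pMl // mulr_gt0 ?exprn_gt0 ?ltr0n.
    lra.
  (* At 1/t both sides of dominance for the image equal 2k [gamma ord0], against strictness. *)
  case/(II_ge_dominant _ hk) => _ _ _ /(_ t^-1); rewrite invr_gt0 => /(_ t0).
  rewrite sum3 => [|i ai]; last by rewrite cT cp ai mulr0 normr0 mul0r.
  rewrite (cT _ ord0) (cT _ ord_max) cT /= p0 pk pj gkE mulrA cE.
  rewrite !ger0_norm ?mulr_ge0 ?ler0n ?exprn_ge0 ?(ltW g0) ?(ltW t0) //.
  have cancel n (b : R) : gamma ord0 * t ^+ n * b * t^-1 ^+ n = gamma ord0 * b.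
    by rewrite exprVn mulrAC mulfK ?expf_neq0 ?gt_eqF.
  rewrite natrB ?(ltnW jlt) // expr0 mulr1 !cancel; lra.
- apply/(II_ge_dominant _ hk); split.
  + exact: size_sumZX.
  + by move=> j; rewrite cT mulr_ge0 // ltW.
  + by rewrite (cT _ ord0) (cT _ ord_max) !mulr_gt0.
  move=> x x0; rewrite (cT _ ord0) (cT _ ord_max) gkE.
  have := dom (t * x) (mulr_gt0 t0 x0); rewrite -(ltr_pM2l g0) mulr_sumr => domT.
  have -> : 2 * (gamma ord0 * p`_(@ord0 k) + gamma ord0 * t ^+ k * p`_(@ord_max k) * x ^+ k)
     = gamma ord0 * (2 * (p`_0 + p`_k * (t * x) ^+ k)).
    by rewrite exprMn /=; ring.
  (* The comparison is termwise: [gamma j] is at most [gamma ord0 * t ^+ j], by hypothesis for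
     interior j and with equality at j = 0 and j = k. *)
  apply: le_lt_trans domT; apply: ler_sum => j _.
  rewrite cT normrM (gtr0_norm (hgamma j)) exprMn.
  rewrite [X in _ <= X](_ : _ = (gamma ord0 * t ^+ j) * (`|p`_j| * x ^+ j)); last by ring.
  rewrite -[X in X <= _]mulrA ler_wpM2r ?mulr_ge0 ?exprn_ge0 ?(ltW x0) //.
  have [jk|] := boolP (0 < j < k)%N; first by rewrite -cond le_g.
  rewrite negb_and -leqNgt leqn0 -leqNgt => /orP[/eqP j0|kj].
    by rewrite (_ : j = ord0) ?expr0 ?mulr1 //; apply: val_inj.
  rewrite (_ : j = ord_max) ?gkE //; apply: val_inj; apply/eqP.
  by rewrite eqn_leq kj -ltnS ltn_ord.
Qed.
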